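(* Let $K$ be a field of characteristic zero, let $n\ge 2$, let $a,b,b_2,\dots,b_n$ be non-negative integers with $\sum_{i=2}^n b_i=b$, and consider the (nonzero) binomial $$F=X_1^a\,(X_1^b-X_2^{b_2}X_3^{b_3}\cdots X_n^{b_n})\in K[X_1,\dots,X_n].$$ Then the algebra $A_F$ with Macaulay dual generator $F$ has the weak Lefschetz property. Moreover, if $a\ge b-1$, then $A_F$ is a complete intersection.
   Context: Let $S=K[X_1,\dots,X_n]$ and $R=K[x_1,\dots,x_n]$, both standard graded, where $R$ acts on $S$ by differentiation: for $p\in R$ and $G\in S$, $p\circ G$ is the result of applying the differential operator $p(\partial/\partial X_1,\dots,\partial/\partial X_n)$ to $G$. For a nonzero homogeneous $F\in S$ put $\operatorname{Ann}_R(F)=\{p\in R : p\circ F=0\}$ and $A_F=R/\operatorname{Ann}_R(F)$. This is a standard graded Artinian Gorenstein $K$-algebra, and $F$ is called its Macaulay dual generator. A standard graded Artinian $K$-algebra $A$ (with degree-$i$ component $[A]_i$) has the weak Lefschetz property if there is a linear form $\ell\in[A]_1$ such that for all integers $i\ge 0$ the multiplication map $\times\ell:[A]_i\to[A]_{i+1}$ has maximal rank (i.e. is injective or surjective). $A_F$ being a complete intersection means that the ideal $\operatorname{Ann}_R(F)$ is generated by a regular sequence in $R$ (equivalently, by $n$ homogeneous elements, since $A_F$ is Artinian). *)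

(* Defs.v *)
From HB Require Import structures.
From mathcomp Require Import all_boot all_order all_algebra ring_quotient.
From mathcomp.multinomials Require Import ssrcomplements mpoly.

Set Implicit Arguments.
Unset Strict Implicit.
Unset Printing Implicit Defensive.

Import GRing.Theory.
Local Open Scope ring_scope.
Local Open Scope quotient_scope.

(* A ring [A] is considered together with a family [gr] of subsets,
   [gr i] being its degree-[i] component. *)
Definition weak_lefschetz (A : comNzRingType) (gr : nat -> A -> Prop) : Prop :=
  exists2 l : A, gr 1%N l &
    forall i : nat,
      (forall x y, gr i x -> gr i y -> l * x = l * y -> x = y) \/
      (forall z, gr i.+1 z -> exists2 x, gr i x & l * x = z).

Definition in_ideal (R : comNzRingType) (s : seq R) (x : R) : Prop :=
  exists c : 'I_(size s) -> R, x = \sum_i c i * s`_i.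

Definition regular_sequence (R : comNzRingType) (s : seq R) : Prop :=
  (forall (i : nat) (g : R), (i < size s)%N ->
     in_ideal (take i s) (s`_i * g) -> in_ideal (take i s) g) /\
  ~ in_ideal s 1.

Section Apolarity.
Variables (K : fieldType) (n : nat).
Implicit Types p q F G : {mpoly K[n]}.

(* p o G, with p acting as the operator p(d/dX_1, ..., d/dX_n) *)
Definition diffop p G : {mpoly K[n]} :=
  \sum_(m <- msupp p) p@_m *: G^`M[m].

Lemma diffopwE k p G : (msize p <= k)%N ->
  diffop p G = \sum_(m : 'X_{1..n < k}) p@_m *: G^`M[m].
Proof.
move=> le_pk; rewrite /diffop (big_mksub 'X_{1..n < k}) /=.
- rewrite big_rmcond //= => m; rewrite -mcoeff_eq0 => /eqP ->.
  by rewrite scale0r.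
- exact: msupp_uniq.
- by move=> m /msize_mdeg_lt /leq_trans; apply.
Qed.

Lemma diffopDl p q G : diffop (p + q) G = diffop p G + diffop q G.
Proof.
pose k := maxn (msize (p + q)) (maxn (msize p) (msize q)).
rewrite !(@diffopwE k) ?leq_max ?leqnn ?orbT // -big_split /=.
by apply: eq_bigr => m _; rewrite mcoeffD scalerDl.
Qed.

Lemma diffopZl c p G : diffop (c *: p) G = c *: diffop p G.
Proof.
pose k := maxn (msize (c *: p)) (msize p).
rewrite !(@diffopwE k) ?leq_max ?leqnn ?orbT // scaler_sumr.
by apply: eq_bigr => m _; rewrite mcoeffZ scalerA.
Qed.

Lemma diffop0l G : diffop 0 G = 0.
Proof. by rewrite /diffop msupp0 big_nil. Qed.

Lemma diffop_suml (I : Type) (r : seq I) (P : pred I) f G :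
  diffop (\sum_(i <- r | P i) f i) G = \sum_(i <- r | P i) diffop (f i) G.
Proof.
exact: (big_morph (fun p => diffop p G) (fun p q => diffopDl p q G) (diffop0l G)).
Qed.

Lemma diffopX m G : diffop 'X_[m] G = G^`M[m].
Proof. by rewrite /diffop msuppX big_seq1 mcoeffX eqxx scale1r. Qed.

Lemma diffop1 G : diffop 1 G = G.
Proof. by rewrite -mpolyX0 diffopX mderivm0m. Qed.

Lemma diffop0r p : diffop p 0 = 0.
Proof.
by rewrite /diffop big1 // => m _; rewrite raddf0 scaler0.
Qed.

Lemma diffopM p q G : diffop (p * q) G = diffop p (diffop q G).
Proof.
rewrite {1}(mpolyE p) mulr_suml diffop_suml; apply: eq_bigr => m _.
rewrite -scalerAl diffopZl; congr (_ *: _).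
rewrite {1}(mpolyE q) mulr_sumr diffop_suml {2}/diffop raddf_sum.
apply: eq_bigr => m' _ /=.
by rewrite -scalerAr -mpolyXD diffopZl diffopX addmC mderivmDm mderivmZ.
Qed.

Definition Ann F : {pred {mpoly K[n]}} := fun p => diffop p F == 0.

Lemma Ann_idealr F : F != 0 -> idealr_closed (Ann F).
Proof.
move=> F0; split.
- by rewrite unfold_in diffop0l.
- by rewrite unfold_in diffop1.
- move=> a p q; rewrite !unfold_in => /eqP hp /eqP hq.
  by rewrite diffopDl diffopM hp hq diffop0r addr0.
Qed.

(* The ideal is proper, as the quotient construction requires, only if F != 0;
   the proof is therefore an argument of this copy of Ann F. *)
Definition Ann_ideal F (F0 : F != 0) : {pred {mpoly K[n]}} := Ann F.

HB.instance Definition _ F (F0 : F != 0) :=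
  isIdealr.Build {mpoly K[n]} (Ann_ideal F0) (Ann_idealr F0).

Definition apolar_algebra F (F0 : F != 0) : comNzRingType :=
  {ideal_quot (Ann_ideal F0)}.

Definition apolar_component F (F0 : F != 0) (i : nat)
    (x : apolar_algebra F0) : Prop :=
  exists2 p : {mpoly K[n]}, p \is i.-homog & x = \pi_{ideal_quot (Ann_ideal F0)} p.

Definition apolar_weak_lefschetz F (F0 : F != 0) : Prop :=
  weak_lefschetz (@apolar_component F F0).

Definition apolar_complete_intersection F : Prop :=
  exists2 s : seq {mpoly K[n]},
    regular_sequence s & forall p, p \in Ann F <-> in_ideal s p.

End Apolarity.

(* Main.v *)
(* Write F = X^d - X_M with d = mdeg M, X = X_1 and M = (a, b_2, ..., b_n).
   By Gorenstein duality the weak Lefschetz property of A_F reduces to the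
   injectivity of the multiplication by a linear form l = t x_1 + x_2 + ... + x_n
   in the single degree i = floor ((d - 1) / 2).  Let p have degree i, with
   (l p) o F = 0.  On the span of the monomials dividing X_M the operator l o _ is
   the lowering operator of an sl2-representation, so it is injective in degrees
   larger than d / 2.  Hence p o F = 0 as soon as x_1^i does not occur in p, because
   (l p) o X^d only sees that coefficient.  Otherwise l o (p o X_M) is a nonzero
   multiple of X^(d - i - 1), and comparing the values t = 1 and t = 2 by
   rescaling X shows that this can happen for at most one of them.
   For b <= a + 1, Ann F is generated by the x_j^(b_j + 1), j >= 2, and by
   x_1^(a + 1) + c x_1^(a + 1 - b) x_2^(b_2) ... x_n^(b_n) for a suitable c <> 0;
   the latter is monic in x_1, so normal forms modulo these generators have
   exponents bounded by M, and no nonzero such polynomial annihilates F. *)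
From HB Require Import structures.
Require Import Defs.
From mathcomp Require Import all_boot all_order all_algebra ring_quotient.
From mathcomp.multinomials Require Import mpoly.
From mathcomp Require Import ring zify.
From Stdlib Require Import Classical.

Set Implicit Arguments.
Unset Strict Implicit.
Unset Printing Implicit Defensive.

Import GRing.Theory.
Local Open Scope ring_scope.
Local Open Scope quotient_scope.

(** * The sl2-action on polynomials whose monomials divide X_M *)

Section Sl2.
Variables (K : fieldType) (n : nat) (w : 'I_n -> K) (M : 'X_{1..n}).
Implicit Types (G : {mpoly K[n]}) (m : 'X_{1..n}).

(** For fixed [e], the weight space of weight 2 e - mdeg M. *)
Definition box_homog (e : nat) G : Prop :=
  forall m, G@_m != 0 -> (m <= M)%MM /\ mdeg m = e.

Definition lower G : {mpoly K[n]} := \sum_j w j *: G^`M(j).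

(* Each factor is the representation of sl2 on polynomials of degree at most M k in
   one variable; [raise1] kills the top power X_k ^ M k. *)
Definition raise1 (k : 'I_n) G : {mpoly K[n]} :=
  (M k)%:R *: ('X_k * G) - 'X_k * ('X_k * G^`M(k)).

(** The inverse weights make the commutator with [lower] independent of [w]. *)
Definition raise G : {mpoly K[n]} := \sum_k (w k)^-1 *: raise1 k G.

Lemma raise1_is_linear k : linear (raise1 k).
Proof.
by move=> c p q; rewrite /raise1 mderivD mderivZ -!mul_mpolyC; ring.
Qed.

HB.instance Definition _ k :=
  GRing.isLinear.Build K {mpoly K[n]} {mpoly K[n]} *:%R (raise1 k)
    (raise1_is_linear k).

Lemma lower_is_linear : linear lower.
Proof.
move=> c p q; rewrite /lower scaler_sumr -big_split; apply: eq_bigr => j _ /=.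
by rewrite mderivD mderivZ scalerDr !scalerA mulrC.
Qed.

HB.instance Definition _ :=
  GRing.isLinear.Build K {mpoly K[n]} {mpoly K[n]} *:%R lower lower_is_linear.

Lemma raise_is_linear : linear raise.
Proof.
move=> c p q; rewrite /raise scaler_sumr -big_split; apply: eq_bigr => j _ /=.
by rewrite raise1_is_linear (scalerDr _ (c *: _)) !scalerA [c * _]mulrC.
Qed.

HB.instance Definition _ :=
  GRing.isLinear.Build K {mpoly K[n]} {mpoly K[n]} *:%R raise raise_is_linear.

Lemma mpolyX_mulderiv k m :
  'X_k * ('X_[m] : {mpoly K[n]})^`M(k) = (m k)%:R *: 'X_[m].
Proof.
rewrite mderivX -scalerAr -mpolyXD.
have [->|m0] := eqVneq (m k) 0%N; first by rewrite !scale0r.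
by rewrite addmC submK // lep1mP.
Qed.

Lemma euler e G : (forall m, G@_m != 0 -> mdeg m = e) ->
  \sum_k 'X_k * G^`M(k) = e%:R *: G.
Proof.
move=> he; rewrite [in RHS](mpolyE G) scaler_sumr.
under eq_bigr => k _ do rewrite {1}(mpolyE G) raddf_sum mulr_sumr.
rewrite exchange_big /=; apply: eq_big_seq => m.
rewrite mcoeff_msupp => /he <-.
under eq_bigr => k _ do rewrite mderivZ -scalerAr mpolyX_mulderiv scalerA mulrC -scalerA.
by rewrite -scaler_suml -natr_sum -mdegE.
Qed.

Lemma mderiv_raise1 j k G :
  (raise1 k G)^`M(j) =
  raise1 k G^`M(j) + (j == k)%:R *: ((M k)%:R *: G - ('X_k * G^`M(k)) *+ 2).
Proof.
have dX : ('X_k : {mpoly K[n]})^`M(j) = ((j == k)%:R)%:MP.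
  rewrite mderivX mnm1E eq_sym; case: eqP => [->|_]; last by rewrite scale0r.
  by rewrite scale1r -{1}(add0m U_(k)%MM) addmK mpolyX0.
rewrite /raise1 mderivB mderivZ !mderivM dX (mderiv_comm j k).
rewrite -!mul_mpolyC.
ring.
Qed.

(** The sl2 commutator relation: variable k contributes M k - 2 X_k d/dX_k, operators in distinct
    variables commute, and Euler's identity sums the contributions. *)
Lemma lower_raise e G : (forall k, w k != 0) -> box_homog e G ->
  lower (raise G) = raise (lower G) + ((mdeg M)%:R - (e * 2)%:R) *: G.
Proof.
move=> w0 hG; rewrite {1}/lower.
under eq_bigr => j _ do
  rewrite /raise (raddf_sum (mderiv j)) scaler_sumr /=.
rewrite exchange_big /=.
transitivity (\sum_k ((w k)^-1 *: raise1 k (lower G)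
    + ((M k)%:R *: G - ('X_k * G^`M(k)) *+ 2))).
  apply: eq_bigr => k _.
  have E j : w j *: ((w k)^-1 *: raise1 k G)^`M(j) =
      (w k)^-1 *: (w j *: raise1 k G^`M(j)) +
      (w j * (w k)^-1 * (j == k)%:R) *: ((M k)%:R *: G - ('X_k * G^`M(k)) *+ 2).
    rewrite mderivZ mderiv_raise1; set A := raise1 k _; set B := _ - _.
    by rewrite -!mul_mpolyC !mpolyCM; ring.
  rewrite (eq_bigr _ (fun j _ => E j)) big_split /= -scaler_sumr; congr (_ + _).
    by congr (_ *: _); rewrite (raddf_sum (raise1 k)); apply: eq_bigr => j _; rewrite [RHS](linearZ_LR (raise1 k)).
  rewrite (bigD1 k) //= big1 ?addr0 => [|j /negPf ->]; last by rewrite mulr0 scale0r.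
  by rewrite eqxx mulr1 mulfV // scale1r.
rewrite big_split /=; congr (_ + _); rewrite sumrB sumrMnl.
rewrite (@euler e) => [|m /hG [] //]; rewrite -scaler_suml -natr_sum -mdegE scalerBl.
by rewrite natrM scalerMnl mulr_natr.
Qed.

(** [raise1 k] maps X_m to (M k - m k) X_k X_m, which is zero when m k = M k, so no exponent
    outgrows [M]. *)
Lemma box_homog_raise e G : box_homog e G -> box_homog e.+1 (raise G).
Proof.
move=> hG m; rewrite (mpolyE G) (raddf_sum raise) (raddf_sum (mcoeff m)) => h.
have [m' m'G] : exists2 m', m' \in msupp G & (raise (G@_m' *: 'X_[m']))@_m != 0.
  apply/hasP; apply: contraNT h => /hasPn h.
  by rewrite big_seq big1 // => k /h; rewrite negbK => /eqP.
rewrite mcoeff_msupp in m'G; have [/mnm_lepP leM degm'] := hG _ m'G.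
rewrite (linearZ_LR raise) mcoeffZ mulf_eq0 negb_or => /andP[_].
rewrite /raise (raddf_sum (mcoeff m)) => h'.
have [k] : exists k, ((w k)^-1 *: raise1 k 'X_[m'])@_m != 0.
  apply/existsP; apply: contraNT h'; rewrite negb_exists => /forallP h'.
  by rewrite big1 // => k _; apply/eqP; move: (h' k); rewrite negbK.
rewrite mcoeffZ mulf_eq0 negb_or => /andP[_].
rewrite /raise1 mpolyX_mulderiv -scalerAr -scalerBl mcoeffZ mulf_eq0 negb_or.
rewrite -mpolyXD mcoeffX => /andP[].
rewrite subr_eq0 => Mk; case: (_ =P m) => [<- _|]; last by rewrite eqxx.
split; last by rewrite mdegD mdeg1 degm' add1n.
apply/mnm_lepP => j; rewrite mnmDE mnm1E; have := leM j.
case: eqP => [kj|_] //; subst j.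
have : M k != m' k by apply: contraNneq Mk => ->.
by lia.
Qed.

(* Lowest weight vectors of the sl2-representation with raising operator [raise]
   and weight 2 degree - mdeg M live in non-positive weights: [lower] maps
   [raise]^(k+1) G to a nonzero multiple of [raise]^k G, and [raise] is nilpotent. *)
Lemma lower_inj e G : [pchar K] =i pred0 -> (forall k, w k != 0) ->
  box_homog e G -> (mdeg M < e * 2)%N -> lower G = 0 -> G = 0.
Proof.
move=> charK w0 hG degG DG0.
have hk k : box_homog (e + k) (iter k raise G).
  elim: k => [|k IH]; first by rewrite addn0.
  by rewrite addnS; apply: box_homog_raise.
(* The coefficient is the sum of the weights 2 (e + s) - mdeg M over s = 0, ..., k, all positive. *)
have DE k : lower (iter k.+1 raise G) =
    - (k.+1 * (e * 2 + k - mdeg M))%:R *: iter k raise G.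
  elim: k => [|k IH].
    rewrite (@lower_raise e) // DG0 raddf0 add0r mul1n addn0 /=.
    by congr (_ *: _); rewrite natrB 1?ltnW // opprB.
  rewrite iterS (lower_raise w0 (hk k.+1)) IH (linearZ_LR raise) -iterS -scalerDl.
  congr (_ *: _).
  rewrite -[(mdeg M)%:R - _]opprB -natrB; last by lia.
  rewrite -opprD -natrD; congr (- (_%:R)); nia.
have top : iter (mdeg M).+1 raise G = 0.
  apply/mpolyP => m; rewrite mcoeff0; apply/eqP/negPn/negP => /hk [/mnm_lepP hm].
  have : (mdeg m <= mdeg M)%N by rewrite !mdegE; apply: leq_sum.
  by lia.
elim: (mdeg M).+1 top => [//|k IH] top; apply: IH.
apply/eqP; move: (DE k); rewrite top raddf0 => /eqP; rewrite eq_sym scaler_eq0.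
case/orP => //; rewrite oppr_eq0 ((pcharf0P K).1 charK) // muln_eq0 => /orP[] //.
by rewrite subn_eq0; lia.
Qed.

End Sl2.

(** * Gorenstein duality and reduction to the middle degree *)

Lemma fredholm (K : fieldType) (I J : finType) (v : I -> J -> K) (w : J -> K) :
  (forall f : J -> K, (forall i, \sum_j v i j * f j = 0) ->
     \sum_j w j * f j = 0) ->
  exists c : I -> K, forall j, w j = \sum_i c i * v i j.
Proof.
move=> orth.
pose V := \matrix_(i < #|I|, j < #|J|) v (enum_val i) (enum_val j).
pose W := \row_(j < #|J|) w (enum_val j).
have sumJ (g : J -> K) : \sum_j g j = \sum_(k < #|J|) g (enum_val k).
  by rewrite (reindex (@enum_val _ J)) //; apply: onW_bij; apply: enum_val_bij.
(* The columns of the cokernel matrix of [V] serve as the test vectors [f]. *)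
have /submxP[D WDV] : (W <= V)%MS.
  rewrite submxE; move: (cokermx V) (mulmx_coker V) => B VB0.
  apply/eqP/matrixP => i k; rewrite !mxE.
  have := orth (fun j => B (enum_rank j) k).
  rewrite sumJ; under [X in _ -> X = 0]eq_bigr do rewrite enum_valK.
  move=> {}orth; rewrite -[RHS]orth => [|i'].
    by apply: eq_bigr => j _; rewrite mxE.
  have := congr1 (fun A : 'M_(_, _) => A (enum_rank i') k) VB0.
  rewrite !mxE sumJ => h; rewrite -[RHS]h; apply: eq_bigr => j _.
  by rewrite mxE enum_valK enum_rankK.
exists (fun i => D 0 (enum_rank i)) => j.
have := congr1 (fun A : 'M_(_, _) => A 0 (enum_rank j)) WDV.
rewrite !mxE enum_rankK => ->.
rewrite [RHS](reindex (@enum_val _ I)); last by apply: onW_bij; apply: enum_val_bij.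
by apply: eq_bigr => i _; rewrite mxE enum_rankK enum_valK.
Qed.

Section Diffop.
Variables (K : fieldType) (n : nat).
Implicit Types (p q F G : {mpoly K[n]}) (m u v : 'X_{1..n}).

Lemma diffopDr p F G : diffop p (F + G) = diffop p F + diffop p G.
Proof.
rewrite /diffop -big_split; apply: eq_bigr => m _ /=.
by rewrite mderivmD scalerDr.
Qed.

Lemma diffopZr p c F : diffop p (c *: F) = c *: diffop p F.
Proof.
rewrite /diffop scaler_sumr; apply: eq_bigr => m _ /=.
by rewrite mderivmZ !scalerA mulrC.
Qed.

Lemma diffopBr p F G : diffop p (F - G) = diffop p F - diffop p G.
Proof. by rewrite diffopDr -scaleN1r diffopZr scaleN1r. Qed.

Lemma diffopBl p q F : diffop (p - q) F = diffop p F - diffop q F.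
Proof. by rewrite diffopDl -scaleN1r diffopZl scaleN1r. Qed.

Lemma mcoeff_diffop p G u :
  (diffop p G)@_u = \sum_(m <- msupp p)
    p@_m * (G@_(m + u) *+ \prod_(i < n) ((m + u)%MM i) ^_ (m i)).
Proof.
rewrite /diffop (raddf_sum (mcoeff u)) /=; apply: eq_bigr => m _.
by rewrite mcoeffZ mcoeff_mderivm.
Qed.

Lemma diffop_neq0 p G u : (diffop p G)@_u != 0 ->
  exists m, p@_m != 0 /\ G@_(m + u) != 0.
Proof.
rewrite mcoeff_diffop => h.
have /hasP[m] : has (fun m => G@_(m + u) != 0) (msupp p).
  apply: contraNT h => /hasPn h; rewrite big_seq big1 // => k /h.
  by rewrite negbK => /eqP ->; rewrite mul0rn mulr0.
by rewrite mcoeff_msupp => pm Gm; exists m.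
Qed.

Lemma dhomog_mdeg d p m : p \is d.-homog -> p@_m != 0 -> mdeg m = d.
Proof. by move=> /dhomogP hp; rewrite -mcoeff_msupp => /hp. Qed.

Lemma diffop_mdeg i d p F u : p \is i.-homog -> F \is d.-homog ->
  (diffop p F)@_u != 0 -> (i + mdeg u)%N = d.
Proof.
move=> hp hF /diffop_neq0[m [pm Fmu]].
by rewrite -(dhomog_mdeg hF Fmu) mdegD (dhomog_mdeg hp pm).
Qed.

Lemma lem_mdeg_exists k u : (k <= mdeg u)%N ->
  exists2 v, (v <= u)%MM & mdeg v = k.
Proof.
elim: k => [|k IH] le_ku; first by exists 0%MM; [apply/mnm_lepP => i; rewrite mnm0E | apply: mdeg0].
have [v /mnm_lepP leuv degv] := IH (ltnW le_ku).
have [i lt_i] : exists i, (v i < u i)%N.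
  apply/existsP; apply: contraLR le_ku; rewrite negb_exists -leqNgt => /forallP le.
  by rewrite -degv !mdegE; apply: leq_sum => i _; move: (le i); rewrite -leqNgt.
exists (v + U_(i))%MM; last by rewrite mdegD mdeg1 degv addn1.
apply/mnm_lepP => j; rewrite mnmDE mnm1E; have := leuv j.
by case: eqP => [<-|_]; lia.
Qed.

Hypothesis charK : [pchar K] =i pred0.

Lemma prod_ffact_neq0 m u :
  (\prod_(i < n) ((m + u)%MM i) ^_ (m i))%:R != 0 :> K.
Proof.
rewrite ((pcharf0P K).1 charK) -lt0n; apply: prodn_gt0 => i.
by rewrite ffact_gt0 mnmDE leq_addr.
Qed.

Lemma mderivm_mcoeff0 m u G : (G^`M[m])@_u = 0 -> G@_(m + u) = 0.
Proof.
rewrite mcoeff_mderivm -mulr_natr => /eqP; rewrite mulf_eq0.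
by rewrite (negPf (prod_ffact_neq0 _ _)) orbF => /eqP.
Qed.

(** Each monomial of [G] has a divisor of degree [k]; in characteristic zero, differentiating by it
    keeps the coefficient nonzero. *)
Lemma mderivm_eq0 k G : (forall u, G@_u != 0 -> (k <= mdeg u)%N) ->
  (forall m, mdeg m = k -> G^`M[m] = 0) -> G = 0.
Proof.
move=> degG dG; apply/mpolyP => u; rewrite mcoeff0; apply/eqP/negPn/negP => Gu.
have [v le_vu degv] := lem_mdeg_exists (degG _ Gu).
case/negP: Gu; rewrite -(submK le_vu) addmC; apply/eqP/mderivm_mcoeff0.
by rewrite dG // mcoeff0.
Qed.

Lemma mcoeff0_mderivm_eq0 k G : (forall u, G@_u != 0 -> mdeg u = k) ->
  (forall m, mdeg m = k -> (G^`M[m])@_0%MM = 0) -> G = 0.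
Proof.
move=> degG dG; apply/mpolyP => u; rewrite mcoeff0; apply/eqP/negPn/negP => Gu.
case/negP: (Gu); rewrite -[u]addm0; apply/eqP/mderivm_mcoeff0.
by rewrite dG // degG.
Qed.

Definition monomials i := {m : 'X_{1..n < i.+1} | mdeg m == i}.

HB.instance Definition _ i := Finite.on (monomials i).

Definition hpoly i (c : monomials i -> K) : {mpoly K[n]} :=
  \sum_s c s *: 'X_[val (val s)].

Lemma hpoly_homog i c : @hpoly i c \is i.-homog.
Proof.
by apply: rpred_sum => m _; apply: rpredZ; rewrite dhomogX; apply: (valP m).
Qed.

Lemma monomials_ex i m : mdeg m = i ->
  exists s : monomials i, m = val (val s).
Proof.
move=> degm; have lt_m : (mdeg m < i.+1)%N by rewrite degm.
have deg_m : mdeg (BMultinom lt_m) == i by rewrite degm.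
by exists (exist _ (BMultinom lt_m) deg_m).
Qed.

Variables (d : nat) (F l : {mpoly K[n]}).
Hypotheses (homF : F \is d.-homog) (homl : l \is 1.-homog).

Definition inj_at i : Prop :=
  forall p, p \is i.-homog -> diffop (l * p) F = 0 -> diffop p F = 0.

(** If l p kills [F], so does l m p for each monomial m of degree j - i; injectivity in degree [j]
    then makes all derivatives of p o F of order j - i vanish. *)
Lemma inj_at_le i j : (i <= j)%N -> (i + j <= d)%N -> inj_at j -> inj_at i.
Proof.
move=> le_ij le_d injj p homp lp0.
apply: (@mderivm_eq0 (j - i)) => [u /(diffop_mdeg homp homF)|m degm].
  by lia.
rewrite -diffopX -diffopM; apply: injj.
  by rewrite -(subnK le_ij) -degm; apply: dhomogM => //; rewrite dhomogX.
by rewrite mulrCA diffopM lp0 diffop0r.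
Qed.

(* Gorenstein duality: the transpose of multiplication by [l] in degree [i] for the
   pairing (p, q) |-> (p q o F)(0) is multiplication by [l] in degree d - 1 - i. *)
Lemma surj_at i z : (i < d)%N -> inj_at (d - i.+1) -> z \is i.+1.-homog ->
  exists2 p, p \is i.-homog & diffop (l * p - z) F = 0.
Proof.
move=> lt_id injj homz; set j := (d - i.+1)%N in injj.
pose phi p : K := (diffop p F)@_0%MM.
have phi_sum k (c h : monomials k -> K) q :
    (forall s, h s = phi (q * 'X_[val (val s)])) ->
    \sum_s h s * c s = phi (q * hpoly c).
  move=> hh; rewrite /phi /hpoly mulr_sumr diffop_suml (raddf_sum (mcoeff _)) /=.
  apply: eq_bigr => m _; rewrite hh.
  by rewrite -scalerAr diffopZl mcoeffZ mulrC.
have phiX p m : phi (p * 'X_[m]) = ((diffop p F)^`M[m])@_0%MM.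
  by rewrite /phi mulrC diffopM diffopX.
(* The unknowns [c] are the coefficients of [p], with one equation for each monomial of degree
   [j]. *)
have [f ortf|c eqw] := @fredholm K (monomials i) (monomials j)
    (fun s t => phi (l * 'X_[val (val s)] * 'X_[val (val t)]))
    (fun t => phi (z * 'X_[val (val t)])).
  rewrite (phi_sum _ f _ z) // /phi diffopM (_ : diffop (hpoly f) F = 0).
    by rewrite diffop0r mcoeff0.
  apply: injj; first exact: hpoly_homog.
  apply: (@mcoeff0_mderivm_eq0 i) => [u|m /monomials_ex[s ->]].
    move/(diffop_mdeg (dhomogM homl (hpoly_homog f)) homF); rewrite /j; lia.
  by rewrite -phiX -[RHS](ortf s) (phi_sum _ f _ (l * 'X_[val (val s)])) // mulrAC.
exists (hpoly c); first exact: hpoly_homog.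
have homr : l * hpoly c - z \is i.+1.-homog.
  by rewrite rpredB // -add1n; apply: dhomogM => //; apply: hpoly_homog.
apply: (@mcoeff0_mderivm_eq0 j) => [u|m /monomials_ex[s ->]].
  by move/(diffop_mdeg homr homF); rewrite /j; lia.
rewrite -phiX mulrBl /phi diffopBl mcoeffB -!/(phi _) eqw.
under eq_bigr => k _ do rewrite mulrC.
rewrite (phi_sum _ c _ (l * 'X_[val (val s)])) => [|k]; last by rewrite mulrAC.
by rewrite mulrAC subrr.
Qed.

(** Degrees up to the middle inherit injectivity from it; in the others below d, surjectivity is
    dual to injectivity in degree d - 1 - i. *)
Lemma weak_lefschetz_of_middle (F0 : F != 0) : (0 < d)%N ->
  inj_at (d.-1)./2 -> apolar_weak_lefschetz F0.
Proof.
move=> d0 inj_mid.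
have piP p q : \pi_{ideal_quot (Ann_ideal F0)} p = \pi_{ideal_quot (Ann_ideal F0)} q
    <-> diffop (p - q) F = 0.
  split=> [/eqP|h]; first by rewrite -Quotient.idealrBE => /eqP.
  by apply/eqP; rewrite -Quotient.idealrBE; apply/eqP.
exists (\pi_{ideal_quot (Ann_ideal F0)} l); first by exists l.
move=> i; case: (leqP (i.*2.+1) d) => [le_id|lt_di].
  left=> _ _ [p homp ->] [q homq ->].
  rewrite -!rmorphM => /piP; rewrite -mulrBr => h; apply/piP.
  have inj_i : inj_at i by apply: inj_at_le inj_mid; lia.
  by apply: inj_i h; rewrite rpredB.
right=> _ [z homz ->]; have [lt_id|le_di] := ltnP i d.
  have inj_j : inj_at (d - i.+1) by apply: inj_at_le inj_mid; lia.
  have [p homp lpz] := surj_at lt_id inj_j homz.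
  exists (\pi_{ideal_quot (Ann_ideal F0)} p); first by exists p.
  by rewrite -rmorphM; apply/piP.
(* For i >= d the target component is zero. *)
exists (\pi_{ideal_quot (Ann_ideal F0)} 0); first by exists 0 => //; apply: rpred0.
rewrite -rmorphM; apply/piP; rewrite mulr0; apply/mpolyP => u; rewrite mcoeff0.
apply/eqP/negPn/negP; rewrite sub0r => /diffop_mdeg => /(_ i.+1 d).
by rewrite rpredN => /(_ homz homF); lia.
Qed.

End Diffop.

(** * Injectivity in the middle degree for the binomial *)

Section Binomial.
Variables (K : fieldType) (n : nat) (x : 'I_n) (M : 'X_{1..n}).
Implicit Types (p q G : {mpoly K[n]}) (m u : 'X_{1..n}) (t : K).

Local Notation d := (mdeg M).

Definition linear_form (w : 'I_n -> K) : {mpoly K[n]} := \sum_j w j *: 'X_j.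

Definition weight t : 'I_n -> K := fun j => if j == x then t else 1.

Definition binomial : {mpoly K[n]} := 'X_[U_(x) *+ d] - 'X_[M].

Lemma linear_form_homog w : linear_form w \is 1.-homog.
Proof.
by apply: rpred_sum => j _; apply: rpredZ; rewrite dhomogX /= mdeg1.
Qed.

Lemma binomial_homog : binomial \is d.-homog.
Proof. by rewrite rpredB // dhomogX //= mdegMn mdeg1 mul1n. Qed.

Lemma diffop_linear_form w G : diffop (linear_form w) G = lower w G.
Proof.
rewrite diffop_suml; apply: eq_bigr => j _.
by rewrite diffopZl diffopX mderivmU1m.
Qed.

Lemma box_homog_diffop i p : p \is i.-homog ->
  box_homog M (d - i) (diffop p 'X_[M]).
Proof.
move=> homp u /diffop_neq0[m [pm]]; rewrite mcoeffX.
case: (M =P _) => [defM _|_]; last by rewrite eqxx.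
rewrite defM mdegD (dhomog_mdeg homp pm) addKn.
by split=> //; apply: lem_addl.
Qed.

Lemma mnm_pure m : (forall j, j != x -> m j = 0%N) -> m = (U_(x) *+ mdeg m)%MM.
Proof.
move=> m0; apply/mnmP => j; rewrite mulmnE mnm1E.
have degm : mdeg m = m x by rewrite mdegE (bigD1 x) //= big1 ?addn0.
by rewrite eq_sym; case: eqVneq => [->|/m0 ->]; rewrite ?mul1n ?mul0n // degm.
Qed.

Lemma diffop_pure i k p : p \is i.-homog ->
  diffop p 'X_[U_(x) *+ k] =
  (p@_(U_(x) *+ i) * (k ^_ i)%:R) *: 'X_[U_(x) *+ (k - i)].
Proof.
move=> homp; rewrite /diffop {3}(mpolyE p) (raddf_sum (mcoeff _)) /=.
rewrite mulr_suml scaler_suml; apply: eq_big_seq => m.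
rewrite mcoeff_msupp mcoeffZ mcoeffX => /(dhomog_mdeg homp) degm.
rewrite mderivmX scalerA -mulrA; case: (m =P _) => [->|ne].
  rewrite mul1r; congr ((_ * _%:R) *: 'X_[_]).
    rewrite (bigD1 x) //= big1 => [|j]; rewrite !mulmnE !mnm1E ?eqxx ?mul1n ?muln1 //.
    by rewrite eq_sym => /negPf ->; rewrite !mul0n.
  by apply/mnmP => j; rewrite mnmBE !mulmnE mnm1E mulnBr.
have [j /andP[jx mj]] : exists j, (j != x) && (m j != 0%N).
  apply/existsP; apply: contra_notT ne; rewrite negb_exists => /forallP m0.
  rewrite -degm; apply: mnm_pure => j jx; apply/eqP.
  by move: (m0 j); rewrite jx negbK.
rewrite (bigD1 j) //= mulmnE mnm1E eq_sym (negPf jx) mul0n.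
by rewrite ffact_small ?lt0n // mul0n mul0r !mulr0 !scale0r.
Qed.

Lemma lower_pure (w : 'I_n -> K) k :
  lower w 'X_[U_(x) *+ k.+1] = (w x * k.+1%:R) *: 'X_[U_(x) *+ k].
Proof.
rewrite /lower (bigD1 x) //= big1 => [|j jx]; rewrite mderivX mulmnE mnm1E.
  rewrite eqxx mul1n addr0 scalerA; congr (_ *: 'X_[_]).
  by rewrite mulmSr addmK.
by rewrite eq_sym (negPf jx) scale0r scaler0.
Qed.

Lemma diffop_linear_form_binomial w i p : p \is i.-homog -> (i < d)%N ->
  diffop (linear_form w * p) binomial = 0 ->
  lower w (diffop p 'X_[M]) =
  (p@_(U_(x) *+ i) * (d ^_ i.+1)%:R * w x) *: 'X_[U_(x) *+ (d - i.+1)].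
Proof.
move=> homp lt_id; rewrite diffopBr => /subr0_eq.
rewrite !diffopM !diffop_linear_form => <-.
rewrite (diffop_pure _ homp) (linearZ_LR (lower w)) /= -(subnSK lt_id) lower_pure scalerA.
by rewrite subnSK // ffactnSr natrM [w x * _]mulrC !mulrA.
Qed.

(** The substitution X_x := t X_x. *)
Definition rescale t G : {mpoly K[n]} :=
  \sum_(m <- msupp G) (G@_m * t ^+ (m x)) *: 'X_[m].

Lemma mcoeff_rescale t G m : (rescale t G)@_m = G@_m * t ^+ (m x).
Proof.
rewrite {2}(mpolyE G) /rescale !(raddf_sum (mcoeff m)) mulr_suml /=.
apply: eq_bigr => u _; rewrite !mcoeffZ mcoeffX.
by case: eqP => [->|_]; rewrite ?mulr0 ?mul0r // !mulr1.
Qed.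

Lemma lower_rescale t G :
  lower (weight 1) (rescale t G) = rescale t (lower (weight t) G).
Proof.
apply/mpolyP => m; rewrite mcoeff_rescale !(raddf_sum (mcoeff m)) mulr_suml /=.
apply: eq_bigr => j _; rewrite !mcoeffZ !mcoeff_deriv mcoeff_rescale /weight.
rewrite mnmDE mnm1E.
by case: eqP => _ /=; rewrite ?addn1 ?exprS ?addn0; ring.
Qed.

Hypothesis charK : [pchar K] =i pred0.

Lemma weight_neq0 t j : t != 0 -> weight t j != 0.
Proof. by rewrite /weight; case: ifP => // _ _; apply: oner_neq0. Qed.

Lemma mcoeff_diffop_monom p m : (m <= M)%MM ->
  (diffop p 'X_[M])@_(M - m) = p@_m * (\prod_(j < n) (M j) ^_ (m j))%:R.
Proof.
move=> le_mM; rewrite mcoeff_diffop {3}(mpolyE p) (raddf_sum (mcoeff m)) mulr_suml /=.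
apply: eq_bigr => u _; rewrite mcoeffZ !mcoeffX -{1}(submK le_mM) addmC eqm_add2r.
rewrite eq_sym; case: eqP => [->|_]; last by rewrite mul0rn mulr0 mul0r.
by rewrite addmC submK // mulr1.
Qed.

Lemma natr_eq (k l : nat) : (k%:R == l%:R :> K) = (k == l).
Proof.
wlog le_kl : k l / (k <= l)%N.
  by move=> W; case/orP: (leq_total k l) => /W // E; rewrite eq_sym E eq_sym.
rewrite eq_sym -subr_eq0 -natrB // ((pcharf0P K).1 charK); lia.
Qed.

(** Otherwise [lower] kills p o X_M, of degree d - i > d / 2, and [lower_inj] gives p o F = 0. *)
Lemma mcoeff_pure_neq0 t i p : t != 0 -> p \is i.-homog -> (i.*2 < d)%N ->
  diffop (linear_form (weight t) * p) binomial = 0 ->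
  diffop p binomial != 0 -> p@_(U_(x) *+ i) != 0.
Proof.
move=> t0 homp lt_id lp0; apply: contraNneq => px0.
rewrite diffopBr (diffop_pure _ homp) px0 mul0r scale0r sub0r oppr_eq0.
apply/eqP/(lower_inj charK _ (box_homog_diffop homp)).
- by move=> j; apply: weight_neq0 t0.
- by lia.
rewrite (diffop_linear_form_binomial homp _ lp0); last by lia.
by rewrite px0 !mul0r scale0r.
Qed.

(* If the injectivity fails for both [x] + (the other variables) and
   2 [x] + (the other variables), the substitution X_x := 2 X_x makes the two
   kernel elements comparable, and [lower_inj] yields 2 ^ (M x) = 2 ^ d. *)
Lemma middle_inj i : (i.*2 < d)%N -> (M x < d)%N ->
  exists w, inj_at binomial (linear_form w) i.
Proof.
move=> lt_id lt_Md.
have two0 : 2%:R != 0 :> K by rewrite ((pcharf0P K).1 charK).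
case: (classic (inj_at binomial (linear_form (weight 1)) i)) => [inj1|ninj1].
  by exists (weight 1).
exists (weight 2%:R) => p2 homp2 lp2; apply/eqP/negPn/negP => p2F.
case: ninj1 => p1 homp1 lp1; apply/eqP/negPn/negP => p1F.
have c1 := mcoeff_pure_neq0 (oner_neq0 K) homp1 lt_id lp1 p1F.
have c2 := mcoeff_pure_neq0 two0 homp2 lt_id lp2 p2F.
have lt_id' : (i < d)%N by lia.
have D1 := diffop_linear_form_binomial homp1 lt_id' lp1.
have D2 := diffop_linear_form_binomial homp2 lt_id' lp2.
have B1 := box_homog_diffop homp1; have B2 := box_homog_diffop homp2.
set G1 := diffop p1 _ in D1 B1; set G2 := diffop p2 _ in D2 B2.
have wx t : weight t x = t by rewrite /weight eqxx.
rewrite wx in D1; rewrite wx in D2.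
(* By [D1], X_x^(d - i - 1) times some variable occurs in [G1] and so divides X_M; hence i <= d - i
   - 1 <= M x. *)
have le_iM : (i <= M x)%N.
  have : (lower (weight 1) G1)@_(U_(x) *+ (d - i.+1)) != 0.
    rewrite D1 mcoeffZ mcoeffX eqxx !mulr1 mulf_neq0 //.
    by rewrite ((pcharf0P K).1 charK) -lt0n ffact_gt0.
  rewrite (raddf_sum (mcoeff _)) /= => h.
  have /existsP[j] : [exists j, G1@_(U_(x) *+ (d - i.+1) + U_(j)) != 0].
    apply: contraNT h; rewrite negb_exists => /forallP h; rewrite big1 // => j _.
    by move: (h j); rewrite negbK mcoeffZ mcoeff_deriv => /eqP ->; rewrite mul0rn mulr0.
  move/B1 => [/mnm_lepP/(_ x)]; rewrite mnmDE mulmnE mnm1E eqxx; lia.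
have le_UM : (U_(x) *+ i <= M)%MM.
  apply/mnm_lepP => j; rewrite mulmnE mnm1E.
  by case: eqP => [<-|_]; rewrite ?mul1n ?mul0n.
(* The factor 2^(d - i) collects 2^(d - i - 1) from rescaling and 2 from the weight, so [lower]
   kills [H]. *)
pose H := (p1@_(U_(x) *+ i)) *: rescale 2%:R G2
          - (p2@_(U_(x) *+ i) * 2%:R ^+ (d - i)) *: G1.
have H0 : H = 0.
  apply: (lower_inj charK (w := weight 1) (M := M) (e := (d - i)%N)).
  - by move=> k; apply/weight_neq0/oner_neq0.
  - move=> u; rewrite mcoeffB !mcoeffZ mcoeff_rescale.
    have [->|/B1 //] := eqVneq (G1@_u) 0.
    have [->|/B2 //] := eqVneq (G2@_u) 0.
    by rewrite !(mul0r, mulr0) subrr eqxx.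
  - by lia.
  rewrite (raddfB (lower _)) /= !(linearZ_LR (lower (weight 1))) /= lower_rescale D1 D2.
  apply/mpolyP => u; rewrite mcoeffB !mcoeffZ mcoeff_rescale mcoeffZ mcoeffX mcoeff0.
  case: eqP => [<-|_]; last by rewrite !(mulr0, mul0r) subrr.
  rewrite mulmnE mnm1E eqxx mul1n -(subnSK lt_id') exprS; ring.
(* At this monomial rescaling contributes 2^(M x - i), to be compared with 2^(d - i). *)
have := congr1 (mcoeff (M - U_(x) *+ i)) H0.
rewrite mcoeffB !mcoeffZ mcoeff_rescale !mcoeff_diffop_monom // mcoeff0.
rewrite mnmBE mulmnE mnm1E eqxx mul1n.
set N := _%:R; have N0 : N != 0 by rewrite /N -{1}(submK le_UM) addmC prod_ffact_neq0.
set C1 := p1@_ _ in c1 *; set C2 := p2@_ _ in c2 * => E.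
have : C1 * C2 * N * (2%:R ^+ (M x - i) - 2%:R ^+ (d - i)) = 0.
  by rewrite -[RHS]E; ring.
move/eqP; rewrite !mulf_eq0 (negPf c1) (negPf c2) (negPf N0) /= subr_eq0 -!natrX.
rewrite natr_eq eqn_exp2l //; lia.
Qed.

End Binomial.

(** * Ideals generated by finite sequences *)

Section InIdeal.
Variables (R : comNzRingType) (s : seq R).
Implicit Types x y : R.

Lemma in_ideal0 : in_ideal s 0.
Proof. by exists (fun=> 0); rewrite big1 // => i _; rewrite mul0r. Qed.

Lemma in_idealD x y : in_ideal s x -> in_ideal s y -> in_ideal s (x + y).
Proof.
move=> [c ->] [c' ->]; exists (fun i => c i + c' i).
by rewrite -big_split; apply: eq_bigr => i _; rewrite mulrDl.
Qed.

Lemma in_idealMl x y : in_ideal s y -> in_ideal s (x * y).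
Proof.
move=> [c ->]; exists (fun i => x * c i).
by rewrite mulr_sumr; apply: eq_bigr => i _; rewrite mulrA.
Qed.

Lemma in_ideal_sum (I : Type) (r : seq I) (P : pred I) (f : I -> R) :
  (forall i, P i -> in_ideal s (f i)) -> in_ideal s (\sum_(i <- r | P i) f i).
Proof. by move=> h; apply: big_ind h => //; [exact: in_ideal0 | exact: in_idealD]. Qed.

Lemma in_ideal_mem x : x \in s -> in_ideal s x.
Proof.
move=> xs; have lt_i : (index x s < size s)%N by rewrite index_mem.
exists (fun i => (i == Ordinal lt_i)%:R).
rewrite (bigD1 (Ordinal lt_i)) //= eqxx mul1r nth_index // big1 ?addr0 //.
by move=> i /negPf ->; rewrite mul0r.
Qed.

End InIdeal.

Lemma in_ideal_subset (R : comNzRingType) (s t : seq R) x :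
  {subset s <= t} -> in_ideal s x -> in_ideal t x.
Proof.
move=> st [c ->]; apply: in_ideal_sum => i _.
exact/in_idealMl/in_ideal_mem/st/mem_nth.
Qed.

(** * Ideals generated by powers of variables *)

Section PowerIdeal.
Variables (K : fieldType) (n : nat).
Implicit Types (p q : {mpoly K[n]}) (m k : 'X_{1..n}).

Lemma mcoeffMXE p k m :
  (p * 'X_[k])@_m = if (k <= m)%MM then p@_(m - k) else 0.
Proof.
case: ifP => [le_km|/negP nle_km].
  by rewrite -{1}(submK le_km) addmC mcoeffMX.
apply/eqP; rewrite mcoeff_eq0; apply/negP; rewrite (perm_mem (msuppMX _ _)).
by case/mapP => m' _ defm; apply: nle_km; rewrite defm lem_addr.
Qed.

Lemma in_ideal_powers (J : seq 'I_n) (e : 'I_n -> nat) p :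
  in_ideal [seq 'X_[U_(j) *+ e j] | j <- J] p <->
  forall m, p@_m != 0 -> has (fun j => e j <= m j)%N J.
Proof.
split=> [[c ->] m|hp].
  apply: contraNT => /hasPn hJ; rewrite (raddf_sum (mcoeff m)) /= big1 // => i _.
  have lt_i : (i < size J)%N by rewrite -(size_map (fun j => 'X_[U_(j) *+ e j] : {mpoly K[n]})).
  have [j0 _] : exists j0 : 'I_n, j0 \in J by exists (tnth (in_tuple J) (Ordinal lt_i)); apply: mem_tnth.
  rewrite (nth_map j0) // mcoeffMXE; case: ifP => // /mnm_lepP le.
  have := hJ _ (mem_nth j0 lt_i).
  by have := le (nth j0 J i); rewrite mulmnE mnm1E eqxx mul1n => ->.
rewrite (mpolyE p) big_seq; apply: in_ideal_sum => m; rewrite mcoeff_msupp.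
case/hp/hasP => j jJ le_em.
have le : (U_(j) *+ e j <= m)%MM.
  by apply/mnm_lepP => i; rewrite mulmnE mnm1E; case: eqP => [<-|]; rewrite ?mul1n ?mul0n.
rewrite -(submK le) mpolyXD -mul_mpolyC mulrA; apply/in_idealMl/in_ideal_mem.
by apply/mapP; exists j.
Qed.

End PowerIdeal.

(** * Generators of the annihilator and their regularity *)

Section BinomialAnn.
Variables (K : fieldType) (n : nat) (x : 'I_n) (M : 'X_{1..n}).
Implicit Types (p q r : {mpoly K[n]}) (m u : 'X_{1..n}).
Local Notation d := (mdeg M).
Local Notation b := (d - M x)%N.
Local Notation F := (binomial K x M).
Hypothesis charK : [pchar K] =i pred0.
Hypotheses (b_gt0 : (0 < b)%N) (le_b : (b <= (M x).+1)%N).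

Definition others := [seq j <- enum 'I_n | j != x].

Definition powers : seq {mpoly K[n]} :=
  [seq 'X_[U_(j) *+ (M j).+1] | j <- others].

(** Its exponent at x is M x + 1 - b, which gives it total degree M x + 1. *)
Definition tail := (M - U_(x) *+ b.-1)%MM.

(** Chosen so that the two multiples of X_x^(b - 1) in [last_gen] o F cancel. *)
Definition tail_coef : K :=
  (d ^_ (M x).+1)%:R / (\prod_(j < n) (M j) ^_ (tail j))%:R.

Definition last_gen : {mpoly K[n]} :=
  'X_[U_(x) *+ (M x).+1] + tail_coef *: 'X_[tail].

Definition gens := powers ++ [:: last_gen].

Lemma mem_others j : (j \in others) = (j != x).
Proof. by rewrite mem_filter mem_enum andbT. Qed.

Lemma has_others (P : pred 'I_n) :
  reflect (exists2 j, j != x & P j) (has P others).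
Proof.
apply: (iffP hasP) => [[j]|[j jx Pj]]; last by exists j; rewrite ?mem_others.
by rewrite mem_others; exists j.
Qed.

Lemma tailE j : tail j = if j == x then ((M x).+1 - b)%N else M j.
Proof.
rewrite mnmBE mulmnE mnm1E eq_sym; case: eqP => [->|_]; rewrite ?mul1n ?subn0 //.
by lia.
Qed.

Lemma exists_other : exists2 j, j != x & M j != 0%N.
Proof.
apply/exists_inP; apply: contraLR b_gt0; rewrite negb_exists_in => /forall_inP M0.
rewrite mdegE (bigD1 x) //= big1 ?addn0 ?subnn // => j /M0.
by rewrite negbK => /eqP.
Qed.

Lemma powers_ann j : j != x -> diffop 'X_[U_(j) *+ (M j).+1] F = 0.
Proof.
move=> jx; rewrite diffopX mderivmB !mderivmX.
have e : (U_(j) *+ (M j).+1)%MM j = (M j).+1 by rewrite mulmnE mnm1E eqxx mul1n.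
rewrite (bigD1 j) //= [X in _ - X%:R *: _](bigD1 j) //= e.
rewrite mulmnE mnm1E eq_sym (negPf jx) mul0n.
by rewrite !ffact_small // !mul0n !scale0r subr0.
Qed.

Lemma last_gen_ann : diffop last_gen F = 0.
Proof.
have tX : (tail == U_(x) *+ (M x).+1)%MM = false.
  apply/negP => /eqP /mnmP /(_ x); rewrite tailE mulmnE mnm1E !eqxx; lia.
have degt : mdeg tail = (M x).+1.
  have : mdeg (tail + U_(x) *+ b.-1) = d.
    rewrite submK //; apply/mnm_lepP => j; rewrite mulmnE mnm1E.
    case: eqP => [<-|_]; lia.
  rewrite mdegD mdegMn mdeg1; lia.
rewrite diffopDl diffopZl /binomial !diffopBr.
rewrite !(@diffop_pure _ _ _ (M x).+1) ?dhomogX /= ?mdegMn ?mdeg1 ?mul1n ?degt //.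
rewrite !mcoeffX eqxx tX !mul0r !scale0r sub0r mul1r !diffopX !mderivmX.
rewrite (bigD1 x) //= !mulmnE !mnm1E eqxx mul1n (ffact_small (ltnSn (M x))).
rewrite mul0n scale0r subr0 scalerN scalerA /tail_coef divfK; last first.
  have le : (tail <= M)%MM by apply: lem_subr.
  by rewrite -{1}(submK le) addmC; apply: prod_ffact_neq0.
suff -> : (M - tail = U_(x) *+ (d - (M x).+1))%MM by rewrite subrr.
apply/mnmP => j; rewrite mnmBE tailE mulmnE mnm1E [x == j]eq_sym.
by case: (j =P x) => [->|_]; rewrite ?mul1n ?mul0n ?subnn //; lia.
Qed.

Lemma gens_ann p : in_ideal gens p -> diffop p F = 0.
Proof.
case=> c ->; rewrite diffop_suml big1 // => i _; rewrite diffopM.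
suff -> : diffop gens`_i F = 0 by rewrite diffop0r.
have := mem_nth 0 (ltn_ord i); rewrite mem_cat inE.
case/orP => [/mapP[j]|/eqP ->]; last exact: last_gen_ann.
by rewrite mem_others => jx ->; apply: powers_ann.
Qed.

(** Rewriting x^(M x + 1) by [last_gen] lowers the exponent of x by b > 0. *)
Lemma reduce_monomial m : exists2 r, in_ideal gens ('X_[m] - r) &
  forall u, r@_u != 0 -> (u x <= M x)%N.
Proof.
have [N] := ubnP (m x); elim: N m => // N IH m ltmN.
have [le_mM|lt_Mm] := leqP (m x) (M x).
  exists 'X_[m]; first by rewrite subrr; apply: in_ideal0.
  by move=> u; rewrite mcoeffX; case: (m =P u) => [<-|_] //; rewrite eqxx.
have le : (U_(x) *+ (M x).+1 <= m)%MM.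
  by apply/mnm_lepP => j; rewrite mulmnE mnm1E; case: eqP => [<-|_]; rewrite ?mul1n ?mul0n.
pose m1 := (m - U_(x) *+ (M x).+1)%MM.
have [|r hr sr] := IH (m1 + tail)%MM.
  by rewrite mnmDE tailE eqxx mnmBE mulmnE mnm1E eqxx; lia.
exists (- tail_coef *: r); last first.
  by move=> u; rewrite mcoeffZ mulf_eq0 negb_or => /andP[_ /sr].
have -> : 'X_[m] - - tail_coef *: r =
    'X_[m1] * last_gen + (- tail_coef)%:MP * ('X_[m1 + tail] - r).
  rewrite -{1}(submK le) -/m1 !mpolyXD /last_gen -!mul_mpolyC mpolyCN; ring.
apply: in_idealD; apply: in_idealMl => //.
by apply: in_ideal_mem; rewrite mem_cat inE eqxx orbT.
Qed.

Lemma reduce p : exists2 r, in_ideal gens (p - r) &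
  forall u, r@_u != 0 -> (u x <= M x)%N.
Proof.
elim/mpolyind: p => [|c m p _ _ [r hr sr]].
  by exists 0; rewrite ?subrr; [apply: in_ideal0 | move=> u; rewrite mcoeff0 eqxx].
have [r' hr' sr'] := reduce_monomial m.
exists (c *: r' + r) => [|u].
  rewrite opprD addrACA; apply: in_idealD => //.
  by rewrite -scalerBr -mul_mpolyC; apply: in_idealMl.
rewrite mcoeffD mcoeffZ; have [r'0|/sr' //] := eqVneq (r'@_u) 0.
by rewrite r'0 mulr0 add0r => /sr.
Qed.

(* A monomial [X_k] dividing [X_M] contributes [X_(M - k)] to [diffop r F]; it can
   only cancel against a derivative of the pure power when [k] agrees with [M] off
   [x], and then against the term of [r] at a pure power, which is absent. *)
Lemma reduced_ann r : (forall u, r@_u != 0 -> (u x <= M x)%N) ->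
  diffop r F = 0 -> in_ideal powers r.
Proof.
move=> sr rF; apply/in_ideal_powers => m rm.
apply: contraT => /has_others nhas.
have le_mM : (m <= M)%MM.
  apply/mnm_lepP => j; have [->|jx] := eqVneq j x; first exact: sr.
  by rewrite leqNgt; apply/negP => lt; apply: nhas; exists j.
have other k : (k <= M)%MM -> r@_k != 0 -> exists k', [/\ r@_k' != 0,
    (forall j, j != x -> k' j = 0%N) & (forall j, j != x -> k j = M j)].
  move=> le_kM rk; have := congr1 (mcoeff (M - k)) rF.
  rewrite diffopBr mcoeffB mcoeff_diffop_monom // mcoeff0.
  have N0 := prod_ffact_neq0 charK k (M - k).
  rewrite addmC submK // in N0 => /eqP; rewrite subr_eq0 => /eqP E.
  have : (diffop r 'X_[U_(x) *+ d])@_(M - k) != 0 by rewrite E mulf_neq0.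
  move/diffop_neq0 => [k' [rk']]; rewrite mcoeffX.
  case: (_ =P (k' + _)%MM) => [/mnmP defd _|_]; last by rewrite eqxx.
  exists k'; split=> // j jx; have := defd j;
    rewrite mnmDE mnmBE mulmnE mnm1E eq_sym (negPf jx); first by lia.
  by have /mnm_lepP/(_ j) := le_kM; lia.
have [k [rk k0 _]] := other _ le_mM rm.
have le_kM : (k <= M)%MM.
  by apply/mnm_lepP => j; have [->|/k0 ->] := eqVneq j x; first exact: sr.
have [_ [_ _ kM]] := other _ le_kM rk.
by have [j jx] := exists_other; rewrite -kM // k0.
Qed.

Lemma AnnE p : diffop p F = 0 <-> in_ideal gens p.
Proof.
split=> [pF|]; last exact: gens_ann.
have [r hr sr] := reduce p.
rewrite -[p](subrK r); apply: in_idealD => //.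
apply: (@in_ideal_subset _ powers) => [q|]; first by rewrite mem_cat => ->.
apply: reduced_ann sr _; have := gens_ann hr.
by rewrite diffopBl pF sub0r => /eqP; rewrite oppr_eq0 => /eqP.
Qed.

(* Modulo [powers], multiplication by [last_gen] is triangular with respect to the
   exponent of [x]: a coefficient only interacts with those of larger exponent. *)
Lemma last_gen_regular q :
  in_ideal powers (last_gen * q) -> in_ideal powers q.
Proof.
move=> /in_ideal_powers hgq; apply/in_ideal_powers => m qm.
apply: contraLR qm => nhas; rewrite negbK; apply/eqP.
(* Descending induction on m x: exponents of at least [msize q] do not occur in [q]. *)
have [N] : exists N, (msize q <= m x + N)%N by exists (msize q); apply: leq_addl.
elim/ltn_ind: N m nhas => N IH m nhas leN.
have [le_sm|lt_ms] := leqP (msize q) (m x).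
  apply: memN_msupp_eq0; apply/negP => /msize_mdeg_lt.
  by rewrite ltnNge (leq_trans le_sm) // mdegE (bigD1 x) //= leq_addr.
(* This coefficient is that of [q] at [m], plus possibly a multiple of one with x-exponent m x +
   b. *)
have : (last_gen * q)@_(m + U_(x) *+ (M x).+1) = 0.
  apply/eqP; apply: contraNT nhas => /hgq /has_others[j jx].
  rewrite mnmDE mulmnE mnm1E eq_sym (negPf jx) mul0n addn0 => lt.
  by apply/has_others; exists j.
rewrite mulrC mulrDr mcoeffD addmC mcoeffMX -scalerAr mcoeffZ mcoeffMXE.
case: ifP => [le_t|_]; last by rewrite mulr0 addr0.
have -> : q@_(U_(x) *+ (M x).+1 + m - tail) = 0; last by rewrite mulr0 addr0.
apply: (IH (N - b)%N).
- by lia.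
- apply: contraNN nhas => /has_others[j jx lt]; apply/has_others; exists j => //.
  apply: leq_trans lt _; rewrite mnmBE mnmDE mulmnE mnm1E tailE eq_sym (negPf jx).
  by lia.
by rewrite mnmBE mnmDE mulmnE mnm1E tailE eqxx; lia.
Qed.

Lemma binomial_complete_intersection : F != 0 -> apolar_complete_intersection F.
Proof.
move=> F0; exists gens; last first.
  by move=> p; rewrite -AnnE; split=> /eqP.
split=> [i g|/AnnE]; last by rewrite diffop1 => /eqP; rewrite (negPf F0).
rewrite size_cat size_map addn1 ltnS leq_eqVlt nth_cat take_cat size_map.
case/orP => [/eqP ->|lt_i].
  by rewrite ltnn subnn take0 cats0; apply: last_gen_regular.
rewrite lt_i -map_take (nth_map x) // => /in_ideal_powers h.
apply/in_ideal_powers => m gm.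
(* This product is divisible by an earlier power, of a different variable since [others] has no
   duplicates; that power divides [m]. *)
have /hasP[j jt] := h (U_(nth x others i) *+ (M (nth x others i)).+1 + m)%MM
  ltac:(by rewrite mulrC mcoeffMX).
rewrite mnmDE mulmnE mnm1E; case: eqP => [E|_]; last first.
  by rewrite mul0n => le; apply/hasP; exists j.
have uo : uniq others by rewrite filter_uniq ?enum_uniq.
move: uo; rewrite -(cat_take_drop i others) cat_uniq => /and3P[_ /hasPn no _].
have /no/negP[] // : j \in drop i others.
rewrite -E -[X in nth x others X]addn0 -nth_drop mem_nth //.
by rewrite size_drop subn_gt0.
Qed.

End BinomialAnn.

(** If M x is the whole degree, X_M is itself the pure power and the two terms cancel. *)
Lemma binomial_neq0 (K : fieldType) (n : nat) (x : 'I_n) (M : 'X_{1..n}) :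
  binomial K x M != 0 -> (M x < mdeg M)%N.
Proof.
apply: contraR; rewrite -leqNgt => le_dM.
suff defM : M = (U_(x) *+ mdeg M)%MM by rewrite /binomial -defM subrr.
apply: mnm_pure => j jx; move: le_dM; rewrite mdegE (bigD1 x) //= (bigD1 j) //=.
by lia.
Qed.


(* The variable X_k is 'X_i with i : 'I_n of value k - 1; b_ is only used at
   indices of positive value. *)
Theorem proposition3p7 (K : fieldType) (charK : [pchar K] =i pred0)
    (n : nat) (n_ge2 : (1 < n)%N)
    (a b : nat) (b_ : 'I_n -> nat)
    (sum_b : (\sum_(i < n | (0 < i)%N) b_ i)%N = b)
    (F : {mpoly K[n]})
    (defF : F = 'X_(Ordinal (ltnW n_ge2)) ^+ a
                * ('X_(Ordinal (ltnW n_ge2)) ^+ b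
                   - \prod_(i < n | (0 < i)%N) 'X_i ^+ b_ i))
    (F_neq0 : F != 0) :
  apolar_weak_lefschetz F_neq0 /\
  ((b <= a + 1)%N -> apolar_complete_intersection F).
Proof.
pose x := Ordinal (ltnW n_ge2).
pose M := [multinom (if i == x then a else b_ i) | i < n].
have neq_x (i : 'I_n) : (0 < i)%N = (i != x) by rewrite lt0n.
have Mx : M x = a by rewrite mnmE eqxx.
have degM : mdeg M = (a + b)%N.
  rewrite mdegE (bigD1 x) //= Mx -sum_b; congr addn.
  by apply: eq_big => i; rewrite ?neq_x // mnmE => /negPf ->.
have {}defF : F = binomial K x M.
  rewrite defF mulrBr -exprD /binomial -mpolyXn degM; congr (_ - _).
  rewrite [in RHS]mpolyXE_id [RHS](bigD1 x) //= Mx; congr (_ * _).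
  by apply: eq_big => i; rewrite ?neq_x // mnmE => /negPf ->.
subst F; have lt_Md := binomial_neq0 F_neq0.
split=> [|le_b]; last by apply: binomial_complete_intersection => //; lia.
have d0 : (0 < mdeg M)%N by lia.
have [|w injw] := @middle_inj K n x M charK (mdeg M).-1./2 _ lt_Md; first by lia.
apply: (weak_lefschetz_of_middle charK _ _ F_neq0 d0 injw).
  exact: binomial_homog.
exact: linear_form_homog.
Qed.
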